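(* Let $\mathcal{E}$ be a class of finite dimensional operator spaces and let $X$ be an $\mathcal{E}$-injective operator space. If an operator space $Y$ satisfies $d_{cb}(Y,X)=1$, then $Y$ is also $\mathcal{E}$-injective.
   Context: Operator spaces are (complete, complex) operator spaces; $\|\cdot\|_{cb}$ is the completely bounded norm. A cb-isomorphism between operator spaces is a linear bijection $\phi$ such that $\phi$ and $\phi^{-1}$ are completely bounded. For operator spaces $V,W$, the completely bounded Banach-Mazur distance is $d_{cb}(V,W)=\inf\{\|\phi\|_{cb}\|\phi^{-1}\|_{cb} : \phi:V\to W \text{ is a cb-isomorphism}\}$ (with $\inf\emptyset=\infty$). An operator space $X$ is called $\mathcal{E}$-injective if for any $\varepsilon>0$, any $E\in\mathcal{E}$ and any subspace $S\subseteq E$, any linear map $u:S\to X$ admits a linear extension $\widetilde{u}:E\to X$ with $\|\widetilde{u}\|_{cb}\le(1+\varepsilon)\|u\|_{cb}$. *)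

(* Defs.v *)
From HB Require Import structures.
From mathcomp Require Import all_boot all_order all_algebra.
From mathcomp Require Import complex.
From mathcomp Require Import all_classical all_reals all_analysis.

Set Implicit Arguments.
Unset Strict Implicit.
Unset Printing Implicit Defensive.
Import Order.TTheory GRing.Theory Num.Theory numFieldNormedType.Exports.

Local Open Scope classical_set_scope.
Local Open Scope complex_scope.
Local Open Scope ring_scope.

Section ScalarMatrices.
Variable R : realType.

Definition l2norm n (x : 'cV[R[i]]_n) : R :=
  Num.sqrt (\sum_(k < n) Normc.normc (x k 0) ^+ 2).

(* The norm of a scalar matrix as a Hilbert space operator l2^n -> l2^m. *)
Definition scalar_opnorm m n (a : 'M[R[i]]_(m, n)) : R :=
  sup [set l2norm (a *m x) | x in [set x : 'cV[R[i]]_n | l2norm x <= 1]].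

(* The product a v b of a matrix v over V by scalar matrices. *)
Definition mxbimul (V : lmodType R[i]) m n
    (a : 'M[R[i]]_(m, n)) (v : 'M[V]_n) (b : 'M[R[i]]_(n, m)) : 'M[V]_m :=
  \matrix_(i, j) \sum_k \sum_l (a i k * b l j) *: v k l.

End ScalarMatrices.

(* Ruan's axioms for the norms on the spaces of n x n matrices over V; the norm
   at level 1 is the norm of V. The space of 0 x 0 matrices is trivial. *)
HB.mixin Record hasMatrixNorms (R : realType) V of NormedModule R[i] V := {
  osnorm : forall n, 'M[V]_n -> R;
  osnorm1E : forall x : V,
    (osnorm 1%N (const_mx x))%:C = `|x|;
  osnorm_triangle : forall n (v w : 'M[V]_n),
    osnorm n (v + w) <= osnorm n v + osnorm n w;
  osnormZ : forall n (c : R[i]) (v : 'M[V]_n),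
    osnorm n (map_mx ( *:%R c) v) = Normc.normc c * osnorm n v;
  osnorm0_eq0 : forall n (v : 'M[V]_n), osnorm n v = 0 -> v = 0;
  osnorm_diag : forall m n (v : 'M[V]_m) (w : 'M[V]_n),
    osnorm (m + n)%N (block_mx v 0 0 w) =
      Num.max (osnorm m v) (osnorm n w);
  osnorm_bimul : forall m n (a : 'M[R[i]]_(m, n)) (v : 'M[V]_n)
      (b : 'M[R[i]]_(n, m)),
    osnorm m (mxbimul a v b) <=
      scalar_opnorm a * osnorm n v * scalar_opnorm b
}.

#[short(type="matrixNormedType")]
HB.structure Definition MatrixNormed (R : realType) :=
  {V of NormedModule R[i] V & hasMatrixNorms R V}.

#[short(type="opSpaceType")]
HB.structure Definition OpSpace (R : realType) :=
  {V of MatrixNormed R V & Complete V}.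

Arguments osnorm {R s n} v : rename.

Section Subspaces.
Variables (R : realType) (V : matrixNormedType R).

Record opsubspace (S : submodClosed V) :=
  OpSubspace { opsubspace_val : V; opsubspace_valP : opsubspace_val \in S }.

Variable S : submodClosed V.

HB.instance Definition _ := [isSub for @opsubspace_val S].
HB.instance Definition _ := [Choice of opsubspace S by <:].
HB.instance Definition _ := [SubChoice_isSubLmodule of opsubspace S by <:].

Let sub_norm (x : opsubspace S) : R[i] := `|val x|.

Let sub_normD x y : sub_norm (x + y) <= sub_norm x + sub_norm y.
Proof. by rewrite /sub_norm raddfD ler_normD. Qed.

Let sub_normZ (c : R[i]) x : sub_norm (c *: x) = `|c| * sub_norm x.
Proof. by rewrite /sub_norm linearZ normrZ. Qed.

Let sub_norm0 x : sub_norm x = 0 -> x = 0.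
Proof. by move=> /normr0_eq0 x0; apply: val_inj; rewrite raddf0. Qed.

HB.instance Definition _ :=
  Lmodule_isNormed.Build R[i] (opsubspace S) sub_normD sub_normZ sub_norm0.

Let sub_osnorm n (v : 'M[opsubspace S]_n) : R := osnorm (map_mx val v).

Let sub_osnorm1E (x : opsubspace S) :
  (sub_osnorm (const_mx x : 'M[opsubspace S]_1))%:C = `|x|.
Proof. by rewrite /sub_osnorm map_const_mx osnorm1E. Qed.

Let sub_osnormD n (v w : 'M[opsubspace S]_n) :
  sub_osnorm (v + w) <= sub_osnorm v + sub_osnorm w.
Proof. by rewrite /sub_osnorm raddfD osnorm_triangle. Qed.

Let sub_osnormZ n (c : R[i]) (v : 'M[opsubspace S]_n) :
  sub_osnorm (map_mx ( *:%R c) v) = Normc.normc c * sub_osnorm v.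
Proof.
rewrite /sub_osnorm -osnormZ; congr osnorm.
by apply/matrixP => i j; rewrite !mxE linearZ.
Qed.

Let sub_osnorm0 n (v : 'M[opsubspace S]_n) : sub_osnorm v = 0 -> v = 0.
Proof.
move=> /osnorm0_eq0 /matrixP v0; apply/matrixP => i j; apply: val_inj.
by move: (v0 i j); rewrite !mxE raddf0.
Qed.

Let sub_osnorm_diag m n (v : 'M[opsubspace S]_m) (w : 'M[opsubspace S]_n) :
  sub_osnorm (block_mx v 0 0 w) = Num.max (sub_osnorm v) (sub_osnorm w).
Proof. by rewrite /sub_osnorm map_block_mx !raddf0 osnorm_diag. Qed.

Let sub_osnorm_bimul m n (a : 'M[R[i]]_(m, n)) (v : 'M[opsubspace S]_n)
    (b : 'M[R[i]]_(n, m)) :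
  sub_osnorm (mxbimul a v b) <=
    scalar_opnorm a * sub_osnorm v * scalar_opnorm b.
Proof.
rewrite /sub_osnorm; have -> : map_mx val (mxbimul a v b) =
    mxbimul a (map_mx val v) b; last exact: osnorm_bimul.
apply/matrixP => i j; rewrite !mxE raddf_sum; apply: eq_bigr => k _.
by rewrite raddf_sum; apply: eq_bigr => l _; rewrite mxE; exact: linearZ.
Qed.

HB.instance Definition _ := hasMatrixNorms.Build R (opsubspace S)
  sub_osnorm1E sub_osnormD sub_osnormZ sub_osnorm0 sub_osnorm_diag
  sub_osnorm_bimul.

End Subspaces.

Section CompletelyBounded.
Variable R : realType.
Implicit Types V W : matrixNormedType R.

(* The norm of the amplification of f to n x n matrices. *)
Definition amp_norm V W (f : V -> W) (n : nat) : \bar R :=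
  ereal_sup
    [set (osnorm (map_mx f v))%:E | v in [set v : 'M[V]_n | osnorm v <= 1]].

Definition cbnorm V W (f : V -> W) : \bar R :=
  ereal_sup [set amp_norm f n | n in [set: nat]].

Definition completely_bounded V W (f : V -> W) : Prop := (cbnorm f < +oo)%E.

Definition cb_isomorphism V W (f : {linear V -> W}) (g : {linear W -> V}) :
    Prop :=
  [/\ cancel f g, cancel g f, completely_bounded f & completely_bounded g].

Definition d_cb V W : \bar R :=
  ereal_inf [set r | exists (f : {linear V -> W}) (g : {linear W -> V}),
    cb_isomorphism f g /\ r = (cbnorm f * cbnorm g)%E].

End CompletelyBounded.

Definition finite_dimensional (R : realType) (V : lmodType R[i]) : Prop :=
  exists (n : nat) (b : 'I_n -> V),
    forall x, exists c : 'I_n -> R[i], x = \sum_(k < n) c k *: b k.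

Definition injective_for (R : realType) (EE : opSpaceType R -> Prop)
    (X : opSpaceType R) : Prop :=
  forall (eps : R) (E : opSpaceType R) (S : submodClosed E)
      (u : {linear opsubspace S -> X}),
    0 < eps -> EE E ->
    exists u' : {linear E -> X},
      (forall s : opsubspace S, u' (val s) = u s) /\
      (cbnorm u' <= (1 + eps)%:E * cbnorm u)%E.

(* Main.v *)
(** Pick a cb-isomorphism [f : Y -> X] with inverse [g] such that
    [||f||_cb ||g||_cb < s] where [s ^ 2 = 1 + eps]. An extension [w] of [f u]
    with [||w||_cb <= s ||f u||_cb] gives the extension [g w] of [g f u = u], and
    [||g w||_cb <= s ||g||_cb ||f||_cb ||u||_cb <= (1 + eps) ||u||_cb]. *)

Require Import Defs.
From HB Require Import structures.
From mathcomp Require Import all_boot all_order all_algebra.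
From mathcomp Require Import complex.
From mathcomp Require Import all_classical all_reals all_analysis.

Set Implicit Arguments.
Unset Strict Implicit.
Unset Printing Implicit Defensive.
Import Order.TTheory GRing.Theory Num.Theory numFieldNormedType.Exports.

Local Open Scope classical_set_scope.
Local Open Scope complex_scope.
Local Open Scope ring_scope.

Section CompletelyBoundedTheory.
Variable R : realType.
Implicit Types V W Z : matrixNormedType R.

Lemma normc_real (r : R) : Normc.normc r%:C = `|r|.
Proof. by rewrite /= expr0n addr0 sqrtr_sqr. Qed.

Lemma osnorm0 V n : osnorm (0 : 'M[V]_n) = 0.
Proof.
have -> : (0 : 'M[V]_n) = map_mx ( *:%R (0%:C : R[i])) (0 : 'M[V]_n).
  by apply/matrixP => i j; rewrite !mxE scaler0.
by rewrite osnormZ normc_real normr0 mul0r.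
Qed.

(** Nonnegativity follows from the triangle inequality for [v] and [-v], since
    [0 = ||v - v|| <= 2 ||v||]. *)
Lemma osnorm_ge0 V n (v : 'M[V]_n) : 0 <= osnorm v.
Proof.
have := osnorm_triangle _ v (map_mx ( *:%R ((-1)%:C : R[i])) v).
have -> : v + map_mx ( *:%R ((-1)%:C : R[i])) v = 0.
  by apply/matrixP => i j; rewrite !mxE rmorphN1 scaleN1r subrr.
by rewrite osnorm0 osnormZ normc_real normrN1 mul1r -mulr2n pmulrn_lge0.
Qed.

Lemma osnorm_map_le_cbnorm V W (f : V -> W) n (v : 'M[V]_n) :
  osnorm v <= 1 -> ((osnorm (map_mx f v))%:E <= cbnorm f)%E.
Proof.
move=> v1; apply: (@le_trans _ _ (amp_norm f n)).
  by apply: ereal_sup_ubound; exists v.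
by apply: ereal_sup_ubound; exists n.
Qed.

Lemma cbnorm_ge0 V W (f : V -> W) : (0 <= cbnorm f)%E.
Proof.
(* The zero matrix lies in the unit ball of every level, and level 0 suffices; as [f] need not be
   linear, only the nonnegativity of the norm of its image is used. *)
apply: le_trans (osnorm_map_le_cbnorm f (v := 0 : 'M[V]_0) _).
  by rewrite lee_fin osnorm_ge0.
by rewrite osnorm0 ler01.
Qed.

Lemma cbnorm_fineK V W (f : V -> W) :
  completely_bounded f -> ((fine (cbnorm f))%:E = cbnorm f)%E.
Proof. by move=> cf; rewrite fineK// ge0_fin_numE// cbnorm_ge0. Qed.

(** By homogeneity, a nonzero [v] can be rescaled to norm one, where the supremum defining
    [cbnorm f] applies; a matrix of norm zero vanishes. *)
Lemma osnorm_map_le V W (f : {linear V -> W}) n (v : 'M[V]_n) :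
  completely_bounded f -> osnorm (map_mx f v) <= fine (cbnorm f) * osnorm v.
Proof.
move=> cf; have [v0|v0] := eqVneq (osnorm v) 0.
  by rewrite (osnorm0_eq0 _ _ v0) raddf0 !osnorm0 mulr0.
have v_gt0 : 0 < osnorm v by rewrite lt_neqAle eq_sym v0 osnorm_ge0.
pose w := map_mx ( *:%R ((osnorm v)^-1%:C : R[i])) v.
have nV : Normc.normc ((osnorm v)^-1%:C : R[i]) = (osnorm v)^-1.
  by rewrite normc_real ger0_norm// invr_ge0 osnorm_ge0.
have w1 : osnorm w <= 1 by rewrite osnormZ nV mulVf.
have := osnorm_map_le_cbnorm f w1.
have -> : map_mx f w = map_mx ( *:%R ((osnorm v)^-1%:C : R[i])) (map_mx f v).
  by apply/matrixP => i j; rewrite !mxE linearZ.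
by rewrite osnormZ nV -cbnorm_fineK// lee_fin mulrC ler_pdivrMr.
Qed.

(** At each level, the bound for [g] is applied to the image under [f] of a matrix in the unit ball.
    Finiteness of both norms lets the estimate take place in [R]. *)
Lemma cbnorm_comp V W Z (g : {linear W -> Z}) (f : {linear V -> W}) :
  completely_bounded g -> completely_bounded f ->
  (cbnorm (g \o f) <= cbnorm g * cbnorm f)%E.
Proof.
move=> cg cf; apply: ge_ereal_sup => _ [n _ <-].
apply: ge_ereal_sup => _ [v v1 <-].
rewrite map_mx_comp -(cbnorm_fineK cg) -(cbnorm_fineK cf) -EFinM lee_fin.
apply: le_trans (osnorm_map_le _ cg) _.
apply: ler_wpM2l; first by rewrite fine_ge0 ?cbnorm_ge0.
by rewrite -lee_fin cbnorm_fineK// osnorm_map_le_cbnorm.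
Qed.

Lemma completely_bounded_comp V W Z (g : {linear W -> Z})
    (f : {linear V -> W}) :
  completely_bounded g -> completely_bounded f -> completely_bounded (g \o f).
Proof.
move=> cg cf; apply: le_lt_trans (cbnorm_comp cg cf) _.
by rewrite -(cbnorm_fineK cg) -(cbnorm_fineK cf) -EFinM ltry.
Qed.

End CompletelyBoundedTheory.

Theorem proposition3p6 (R : realType) (EE : opSpaceType R -> Prop)
    (EE_fin : forall E : opSpaceType R, EE E -> finite_dimensional E)
    (X : opSpaceType R) (X_inj : injective_for EE X)
    (Y : opSpaceType R) (dYX : d_cb Y X = 1%E) :
  injective_for EE Y.
Proof.
move=> eps E S u eps0 EEE.
pose s := Num.sqrt (1 + eps).
have eps1_ge0 : 0 <= 1 + eps by rewrite addr_ge0// ltW.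
have s1 : 1 < s by rewrite -sqrtr1 ltr_sqrt ?ltrDl// ltr_wpDr// ltW.
have s0 : 0 <= s by rewrite sqrtr_ge0.
have : (d_cb Y X < s%:E)%E by rewrite dYX lte_fin.
move=> /ereal_inf_lt[_ [f [g [[fK gK cf cg] ->]]]] fg_lt.
have s1_gt0 : 0 < s - 1 by rewrite subr_gt0.
(* The tolerance [s - 1] makes the extension factor [1 + (s - 1) = s]. *)
have [w [wE wle]] := X_inj (s - 1) E S (f \o u) s1_gt0 EEE.
exists (g \o w); split=> [x|]; first by rewrite /= wE /= fK.
(* If [u] is not completely bounded, the required bound is [+oo], because [1 + eps > 0]. *)
have [cu|] := boolP (cbnorm u < +oo)%E; last first.
  rewrite -leNgt leye_eq => /eqP ->.
  by rewrite gt0_muley ?leey// lte_fin addr_gt0.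
have cfu := completely_bounded_comp cf cu.
move: wle; rewrite addrC subrK => wle.
have cw : completely_bounded w.
  by apply: le_lt_trans wle _; rewrite -(cbnorm_fineK cfu) -EFinM ltry.
apply: le_trans (cbnorm_comp cg cw) _.
have fule := cbnorm_comp cf cu.
have u0 := cbnorm_ge0 u; have g0 := cbnorm_ge0 g.
(* All the cb-norms involved are now finite, so the inequalities are transferred to [R]. *)
move: wle fule fg_lt u0 g0.
rewrite -(cbnorm_fineK cfu) -(cbnorm_fineK cw) -(cbnorm_fineK cf).
rewrite -(cbnorm_fineK cg) -(cbnorm_fineK cu) -!EFinM !lee_fin lte_fin.
move=> wle fule /ltW fg_le u0 g0.
(* In [1 + eps = s * s], one factor [s] pays for the extension [w] and the other bounds
   [||f||_cb ||g||_cb]. *)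
rewrite -(sqr_sqrtr eps1_ge0) -/s expr2 -mulrA.
apply: le_trans (ler_wpM2l g0 wle) _; rewrite mulrCA ler_wpM2l//.
apply: le_trans (ler_wpM2l g0 fule) _; rewrite mulrA ler_wpM2r//.
by rewrite mulrC.
Qed.
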